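(* For arbitrary integers $N\geq 2$ and $n\geq 3$, the ideal $I_{N,n}\subset\mathbb{C}[x_0,\ldots,x_N]$ satisfies $$I_{N,n}^{(3)}\not\subset I_{N,n}^2,$$ where $I_{N,n}^{(3)}$ is the third symbolic power and $I_{N,n}^2$ the second ordinary power of $I_{N,n}$.
   Context: Let $R=\mathbb{C}[x_0,\ldots,x_N]$ be the homogeneous coordinate ring of the complex projective space $\mathbb{P}^N$. The Fermat-type arrangement of hyperplanes of degree $n$ in $\mathbb{P}^N$ consists of the hyperplanes defined by the linear factors of $$F_{N,n}=\prod_{0\leq i<j\leq N}(x_i^n-x_j^n).$$ Let $V_{N,n}\subset\mathbb{P}^N$ be the union of all codimension $2$ linear subspaces (flats) $W$ of $\mathbb{P}^N$ such that at least $3$ distinct hyperplanes of this arrangement contain $W$. Let $I_{N,n}\subset R$ be the radical homogeneous ideal defining $V_{N,n}$, i.e. the ideal of all polynomials vanishing along $V_{N,n}$. For an ideal $I\subset R$ and an integer $m\geq 0$, the $m$-th symbolic power of $I$ is $$I^{(m)}=\bigcap_{P\in\mathrm{Ass}(I)}\left(I^mR_P\cap R\right),$$ where $\mathrm{Ass}(I)$ is the set of associated primes of $I$ and $I^mR_P\cap R$ denotes the preimage of $I^mR_P$ in $R$. *)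

(* Defs.v *)
From HB Require Import structures.
From mathcomp Require Import all_boot all_order all_algebra.
From mathcomp Require Import boolp classical_sets reals.
From mathcomp Require Import complex mpoly.

Set Implicit Arguments.
Unset Strict Implicit.
Unset Printing Implicit Defensive.

Import GRing.Theory.

Local Open Scope ring_scope.
Local Open Scope classical_set_scope.

Local Notation "x %:F" := (@FracField.tofrac _ x).

Definition ideal_gen (A : comNzRingType) (S : set A) : set A :=
  [set x | exists (k : nat) (a s : 'I_k -> A),
     (forall i, S (s i)) /\ x = \sum_(i < k) a i * s i].

Definition ideal_pow (A : comNzRingType) (I : set A) (m : nat) : set A :=
  ideal_gen [set x | exists f : 'I_m -> A,
     (forall i, I (f i)) /\ x = \prod_(i < m) f i].

Definition prime_ideal (A : comNzRingType) (P : set A) : Prop :=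
  idealr_closed (mem P) /\ prime_idealr_closed (mem P).

(* Ass(I) is Ass(A / I): the primes that are the annihilator of the class of
   some f in A / I. *)
Definition Ass (A : comNzRingType) (I : set A) : set (set A) :=
  [set P | prime_ideal P /\ exists f : A, P = [set g | I (g * f)]].

(* For a prime P of a domain A, the localization A_P as a subring of the
   fraction field of A. *)
Definition localization (A : idomainType) (P : set A) : set {fraction A} :=
  [set x | exists a s : A, ~ P s /\ x = a%:F / s%:F].

(* The ideal J A_P of A_P generated by the image of J. *)
Definition extension (A : idomainType) (P J : set A) : set {fraction A} :=
  [set x | exists (k : nat) (c : 'I_k -> {fraction A}) (b : 'I_k -> A),
     [/\ forall i, localization P (c i), forall i, J (b i)
       & x = \sum_(i < k) c i * (b i)%:F]].

Definition symbolic_power (A : idomainType) (I : set A) (m : nat) : set A :=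
  \bigcap_(P in Ass I) [set g | extension P (ideal_pow I m) g%:F].

Definition fermat_poly (K : fieldType) (N n : nat) : {mpoly K[N.+1]} :=
  \prod_(i < N.+1) \prod_(j < N.+1 | (i < j)%N) ('X_i ^+ n - 'X_j ^+ n).

(* Linear subspaces of P^N are represented by the corresponding vector
   subspaces of K^(N+1), and points of P^N by nonzero vectors. *)
Definition fermat_hyperplane (K : fieldType) (N n : nat) :
    set {vspace 'rV[K]_N.+1} :=
  [set H : {vspace _} | exists l : {mpoly K[N.+1]},
     [/\ l != 0, l \is 1.-homog,
         exists q, fermat_poly K N n = l * q
       & forall v : 'rV[K]_N.+1, v \in H <-> l.@[fun i => v 0 i] = 0]].

(* Codimension 2 in P^N means vector space dimension N + 1 - 2. *)
Definition fermat_flat (K : fieldType) (N n : nat) :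
    set {vspace 'rV[K]_N.+1} :=
  [set W : {vspace _} | (\dim W + 2 = N.+1)%N /\
     exists H1 H2 H3 : {vspace 'rV[K]_N.+1},
       [/\ H1 <> H2, H1 <> H3 & H2 <> H3] /\
       [/\ fermat_hyperplane n H1, fermat_hyperplane n H2
         & fermat_hyperplane n H3] /\
       [/\ (W <= H1)%VS, (W <= H2)%VS & (W <= H3)%VS]].

Definition fermat_locus (K : fieldType) (N n : nat) : set 'rV[K]_N.+1 :=
  [set v | v != 0 /\ exists2 W : {vspace _}, fermat_flat n W & v \in W].

Definition fermat_ideal (K : fieldType) (N n : nat) : set {mpoly K[N.+1]} :=
  [set f | forall v, @fermat_locus K N n v -> f.@[fun i => v 0 i] = 0].

(* Main.v *)
(** The witness is the product F of all the linear forms of the arrangement.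

    F is in the third symbolic power: an associated prime (I : f) comes with a
    flat W on which f does not vanish.  Let s be the product of the linear
    factors of F that do not vanish on W; every other flat lies on one of them,
    so s l is in I for each factor l vanishing on W.  There are at least three
    such l, so s^3 F is in I^3, while s^3 f is not in I because W is irreducible.

    F is not in I^2: giving x_3, ..., x_N nonzero values with distinct n-th
    powers sends I into the ideal J of K[x, y, z] vanishing at the n^2 points
    (1 : w^b : w^c) and at the three coordinate points, and sends F to
    (x^n - y^n)(x^n - z^n)(y^n - z^n) U with U(0) <> 0.  The functional
    [x^n y^2n] - [x^n z^2n] does not vanish on this product, but it vanishes on
    J^2.  Indeed g in J has no pure powers, no monomial x^i y^j or x^i z^j with
    0 < i, j < n, and opposite coefficients at x^i y^n and x^i z^n for
    0 < i < n; so both coefficients of a product f g are equal to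
    sum_i [x^i y^n] f [x^(n-i) y^n] g = sum_i [x^i z^n] f [x^(n-i) z^n] g. *)

Require Import Defs.
From mathcomp Require Import all_boot all_order all_algebra.
From mathcomp Require Import boolp classical_sets reals.
From mathcomp Require Import complex mpoly.
From mathcomp Require Import separable cyclic cyclotomic ring zify.

Set Implicit Arguments.
Unset Strict Implicit.
Unset Printing Implicit Defensive.

Import GRing.Theory Num.Theory.
Local Open Scope ring_scope.

(** * Roots of unity and one-variable polynomials in characteristic zero *)

Lemma primitive_root_exists (K : numClosedFieldType) n :
  (0 < n)%N -> exists w : K, n.-primitive_root w.
Proof.
move=> n_gt0; pose p : {poly K} := 'X^n - 1.
have [r Dp] := closed_field_poly_normal p.
rewrite (monicP _) ?monicXnsubC // scale1r in Dp.
have rn1: all n.-unity_root r by apply/allP=> z; rewrite -root_prod_XsubC -Dp.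
have sz_r: (n < (size r).+1)%N.
  by rewrite -(size_prod_XsubC r id) -Dp size_XnsubC.
have [|z] := hasP (has_prim_root n_gt0 rn1 _ sz_r); last by exists z.
by rewrite -separable_prod_XsubC -Dp separable_Xn_sub_1 // pnatr_eq0 -lt0n.
Qed.

(** In characteristic zero the integers [1, ..., size p] are distinct nonzero roots, one too many
    for a nonzero [p]. *)
Lemma poly_eq0_char0 (K : numFieldType) (p : {poly K}) :
  (forall t, t != 0 -> p.[t] = 0) -> p = 0.
Proof.
move=> p0; apply/eqP/contraT => pn0.
have := @max_poly_roots _ p [seq (i.+1)%:R | i <- iota 0 (size p)] pn0.
rewrite size_map size_iota ltnn; apply.
  by apply/allP => _ /mapP[i _ ->]; apply/rootP/p0; rewrite pnatr_eq0.
rewrite map_inj_uniq ?iota_uniq // => i j /eqP.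
by rewrite eqr_nat => /eqP [].
Qed.

(** The sum is a polynomial in [t] with infinitely many roots, so its coefficient at [t^e]
    vanishes. *)
Lemma sum_expr_eq0 (K : numFieldType) (I : Type) (r : seq I) (P : pred I)
    (c : I -> K) (d : I -> nat) (e : nat) :
    (forall t, t != 0 -> \sum_(i <- r | P i) c i * t ^+ d i = 0) ->
  \sum_(i <- r | P i && (d i == e)) c i = 0.
Proof.
move=> h; have: \sum_(i <- r | P i) c i *: 'X^(d i) = 0 :> {poly K}.
  apply: poly_eq0_char0 => t /h <-; rewrite horner_sum.
  by apply: eq_bigr => i _; rewrite hornerZ hornerXn.
move/(congr1 (coefp e)); rewrite /= coef0 coef_sum => eq0.
rewrite big_mkcondr -[RHS]eq0; apply: eq_bigr => i _; rewrite coefZ coefXn eq_sym.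
by case: eqP; rewrite ?mulr1 ?mulr0.
Qed.

(** Orthogonality of characters: unless [w^k = 1], the geometric sum is killed by the nonzero factor
    [w^k - 1]. *)
Lemma sum_prim_root_expr (K : fieldType) n (w : K) k :
  n.-primitive_root w ->
  \sum_(b < n) w ^+ (b * k) = if (n %| k)%N then n%:R else 0.
Proof.
move=> wP; under eq_bigr do rewrite mulnC exprM.
case: ifPn => [/dvdnP[q ->]|nk].
  rewrite mulnC exprM (prim_expr_order wP) expr1n.
  by under eq_bigr do rewrite expr1n; rewrite sumr_const card_ord.
have w1 : w ^+ k - 1 != 0 by rewrite subr_eq0 -(prim_order_dvd wP).
by apply: (mulfI w1); rewrite -subrX1 -exprM mulnC exprM (prim_expr_order wP)
  expr1n subrr mulr0.
Qed.

(** * Coefficients of products of multivariate polynomials *)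

Section Mcoeff.
Variables (K : comNzRingType) (l : nat).
Implicit Types (g h : {mpoly K[l]}) (m : 'X_{1..l}).

(** Trades the unknown support of [g] for an explicit list; the list may contain monomials outside
    the support, whose coefficients are zero. *)
Lemma sum_msupp_seq g (c : 'X_{1..l} -> K) (s : seq 'X_{1..l}) :
  uniq s -> (forall m, m \notin s -> g@_m * c m = 0) ->
  \sum_(m <- msupp g) g@_m * c m = \sum_(m <- s) g@_m * c m.
Proof.
move=> us h.
rewrite (bigID (fun m => m \in s)) /= [X in _ + X]big1; last first.
  by move=> m; exact: h.
rewrite addr0 [RHS](bigID (fun m => m \in msupp g)) /= [X in _ = _ + X]big1.
  rewrite addr0 -!(big_filter _ (fun m => _ \in _)); apply: perm_big.
  apply: uniq_perm; rewrite ?filter_uniq ?msupp_uniq // => m.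
  by rewrite !mem_filter andbC.
by move=> m; rewrite -mcoeff_eq0 => /eqP ->; rewrite mul0r.
Qed.

Lemma mcoeffXM m g m' :
  ('X_[m] * g)@_m' = if (m <= m')%MM then g@_(m' - m) else 0.
Proof.
case: ifPn => [le_mm'|].
  by rewrite -[in LHS](submK le_mm') addmC mulrC mcoeffMX.
apply: contraNeq; rewrite -mcoeff_msupp mulrC (perm_mem (msuppMX _ _)).
by case/mapP => m0 _ ->; exact: lem_addr.
Qed.

Lemma mcoeffM_msupp g h m' :
  (g * h)@_m' =
  \sum_(m <- msupp g) g@_m * (if (m <= m')%MM then h@_(m' - m) else 0).
Proof.
rewrite {1}(mpolyE g) big_distrl /= linear_sum /=.
by apply: eq_bigr => m _; rewrite -scalerAl mcoeffZ mcoeffXM.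
Qed.

End Mcoeff.

(** * Monomials and evaluation in three variables *)

Definition point3 (K : Type) (x y z : K) (i : 'I_3) : K := nth x [:: x; y; z] i.

Definition mnm3 (i j k : nat) : 'X_{1..3} := [multinom point3 i j k u | u < 3].

Lemma mnm3E i j k u : mnm3 i j k u = point3 i j k u.
Proof. exact: mnmE. Qed.

Lemma mnm3P (m : 'X_{1..3}) i j k :
  (m == mnm3 i j k) = [&& m ord0 == i, m (inord 1) == j & m (inord 2) == k].
Proof.
apply/eqP/and3P => [->|[/eqP m0 /eqP m1 /eqP m2]].
  by rewrite !mnm3E /point3 !inordK.
apply/mnmP => u; rewrite mnm3E /point3; case: u => [[|[|[|//]]] lt_u] /=.
- by rewrite -m0; congr (m _); apply/val_inj.
- by rewrite -m1; congr (m _); apply/val_inj; rewrite /= inordK.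
- by rewrite -m2; congr (m _); apply/val_inj; rewrite /= inordK.
Qed.

Lemma mnm3_eta (m : 'X_{1..3}) :
  m = mnm3 (m ord0) (m (inord 1)) (m (inord 2)).
Proof. by apply/eqP; rewrite mnm3P !eqxx. Qed.

Lemma mnm3_le i j k i' j' k' :
  (mnm3 i j k <= mnm3 i' j' k')%MM = [&& i <= i', j <= j' & k <= k']%N.
Proof.
apply/mnm_lepP/and3P => [h|[h0 h1 h2]].
  have := (h ord0, h (inord 1), h (inord 2)).
  by rewrite !mnm3E /point3 !inordK //= => -[[]].
by case=> [[|[|[|//]]] lt_u]; rewrite !mnm3E.
Qed.

Lemma mnm3B i j k i' j' k' :
  (mnm3 i j k - mnm3 i' j' k')%MM = mnm3 (i - i') (j - j') (k - k').
Proof. by apply/mnmP => -[[|[|[|//]]] lt_u]; rewrite mnmBE !mnm3E. Qed.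

Lemma meval_point3 (K : comNzRingType) (g : {mpoly K[3]}) x y z :
  g.@[point3 x y z] = \sum_(m <- msupp g)
    g@_m * (x ^+ m ord0 * y ^+ m (inord 1) * z ^+ m (inord 2)).
Proof.
rewrite mevalE; apply: eq_bigr => m _; congr (_ * _).
rewrite !big_ord_recl big_ord0 mulr1 mulrA; congr (_ * _ ^+ m _ * _ ^+ m _);
  by apply/val_inj; rewrite /= inordK.
Qed.
(** Turns vanishing along lines into a linear relation between coefficients: [d] records the power
    of [t] carried by a monomial, and the weight [c], cut down to [d m = e], is [a] times the
    indicator of [s]. *)
Lemma sum_coef_vanishing (K : numFieldType) l (g : {mpoly K[l]})
    (c : 'X_{1..l} -> K) (d : 'X_{1..l} -> nat) (e : nat) (s : seq 'X_{1..l})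
    (a : K) :
    uniq s -> a != 0 ->
    (forall t, t != 0 -> \sum_(m <- msupp g) g@_m * (c m * t ^+ d m) = 0) ->
    (forall m, (if d m == e then c m else 0) = if m \in s then a else 0) ->
  \sum_(m <- s) g@_m = 0.
Proof.
move=> us an0 g0 cE; apply: (mulIf an0); rewrite mul0r big_distrl /=.
have eq0 : \sum_(m <- msupp g | xpredT m && (d m == e)) g@_m * c m = 0.
  apply: sum_expr_eq0 => t /g0 g0t; rewrite -[RHS]g0t.
  by apply: eq_bigr => m _; rewrite mulrA.
rewrite -[RHS]eq0; transitivity (\sum_(m <- s) g@_m * (if m \in s then a else 0)).
  by rewrite big_seq [RHS]big_seq; apply: eq_bigr => m ->.
rewrite -sum_msupp_seq // => [|m /negPf ->]; last by rewrite mulr0.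
rewrite [RHS]big_mkcond; apply: eq_bigr => m _ /=.
by rewrite -cE; case: eqP; rewrite ?mulr0.
Qed.

(** The boolean chooses between the variables y and z, so that one argument serves both. *)
Definition mnm3_axis (b : bool) i j := if b then mnm3 i j 0 else mnm3 i 0 j.

(** * Linear conditions on the coefficients of a polynomial vanishing on the cone *)

Section ConeOverFermatPoints.
Variables (K : numFieldType) (n : nat) (w : K).
Hypothesis wP : n.-primitive_root w.

(** Specialized polynomials need not be homogeneous, so vanishing is required along whole punctured
    lines; varying [t] then separates the degrees. *)
Definition vanishes_on_cone (g : {mpoly K[3]}) :=
  forall t, t != 0 ->
  [/\ g.@[point3 t 0 0] = 0, g.@[point3 0 t 0] = 0, g.@[point3 0 0 t] = 0
    & forall b c, g.@[point3 t (w ^+ b * t) (w ^+ c * t)] = 0].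

Lemma vanishes_on_coneM f g :
  vanishes_on_cone g -> vanishes_on_cone (f * g).
Proof.
by move=> gV t /gV [g0 g1 g2 g3]; split=> [|||b c]; rewrite mevalM ?g0 ?g1 ?g2
  ?g3 mulr0.
Qed.

Variable g : {mpoly K[3]}.
Hypothesis gV : vanishes_on_cone g.

(** On a coordinate axis only pure powers survive: the weight [0 ^+ k] is the indicator of
    [k = 0]. *)
Lemma cone_coef_axis i :
  [/\ g@_(mnm3 i 0 0) = 0, g@_(mnm3 0 i 0) = 0 & g@_(mnm3 0 0 i) = 0].
Proof.
split; rewrite -[LHS](big_seq1 +%R _ (fun m => g@_m)).
- apply: (@sum_coef_vanishing _ _ g
    (fun m => 0 ^+ m (inord 1) * 0 ^+ m (inord 2)) (fun m => m ord0) i _ 1);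
    rewrite ?oner_eq0 //.
    move=> t /gV [g0 _ _ _]; rewrite -[RHS]g0 meval_point3.
    by apply: eq_bigr => m _; congr (_ * _); rewrite mulrC mulrA.
  move=> m; rewrite inE mnm3P; case: eqP => //= _.
  by rewrite !expr0n -natrM mulnb; case: andP.
- apply: (@sum_coef_vanishing _ _ g
    (fun m => 0 ^+ m ord0 * 0 ^+ m (inord 2)) (fun m => m (inord 1)) i _ 1);
    rewrite ?oner_eq0 //.
    move=> t /gV [_ g0 _ _]; rewrite -[RHS]g0 meval_point3.
    by apply: eq_bigr => m _; congr (_ * _); rewrite -!mulrA [0 ^+ _ * t ^+ _]mulrC.
  move=> m; rewrite inE mnm3P andbCA; case: eqP => //= _.
  by rewrite !expr0n -natrM mulnb; case: andP.
- apply: (@sum_coef_vanishing _ _ g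
    (fun m => 0 ^+ m ord0 * 0 ^+ m (inord 1)) (fun m => m (inord 2)) i _ 1);
    rewrite ?oner_eq0 //.
    by move=> t /gV [_ _ g0 _]; rewrite -[RHS]g0 meval_point3.
  move=> m; rewrite inE mnm3P andbA andbC; case: eqP => //= _.
  by rewrite !expr0n -natrM mulnb; case: andP.
Qed.

(* The sum over [b] and [c] is an average over the n^2 lines through the points
   (1 : w^b : w^c), against a character: it isolates one class of exponents
   modulo [n]. *)
Lemma cone_coef_class (s : seq 'X_{1..3}) e j k :
    uniq s ->
    (forall m, (m \in s) = [&& (m ord0 + m (inord 1) + m (inord 2) == e)%N,
      (n %| m (inord 1) + j)%N & (n %| m (inord 2) + k)%N]) ->
  \sum_(m <- s) g@_m = 0.
Proof.
move=> us sE.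
have n_gt0 := prim_order_gt0 wP.
apply: (@sum_coef_vanishing _ _ g
  (fun m => (\sum_(b < n) w ^+ (b * (m (inord 1) + j))) *
    (\sum_(c < n) w ^+ (c * (m (inord 2) + k))))
  (fun m => m ord0 + m (inord 1) + m (inord 2))%N e _ (n%:R * n%:R)) => //.
- by rewrite mulf_eq0 orbb pnatr_eq0 -lt0n.
- move=> t /gV [_ _ _ gd].
  have: \sum_(b < n) \sum_(c < n) w ^+ (b * j) * w ^+ (c * k) *
      g.@[point3 t (w ^+ b * t) (w ^+ c * t)] = 0.
    by rewrite big1 // => b _; rewrite big1 // => c _; rewrite gd mulr0.
  move=> eq0; rewrite -[RHS]eq0.
  under [RHS]eq_bigr do
    under eq_bigr do rewrite meval_point3 big_distrr.
  under [RHS]eq_bigr do rewrite exchange_big.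
  rewrite exchange_big; apply: eq_bigr => m _ /=.
  rewrite big_distrlr big_distrl big_distrr; apply: eq_bigr => b _ /=.
  rewrite big_distrl big_distrr; apply: eq_bigr => c _ /=.
  rewrite !mulnDr !exprD !exprMn -!exprM.
  ring.
- move=> m; rewrite sE !(sum_prim_root_expr _ wP).
  by case: eqP => //= _; do 2![case: ifP => //= _]; rewrite ?mul0r ?mulr0.
Qed.
(** In degree [i + j] the class of this monomial modulo [n] is a singleton: moving any exponent by
    [n] is impossible since [i] and [j] are less than [n]. *)
Lemma cone_coef_small b i j :
  (0 < i < n)%N -> (0 < j < n)%N -> g@_(mnm3_axis b i j) = 0.
Proof.
move=> /andP[i_gt0 i_ltn] /andP[j_gt0 j_ltn].
rewrite -[LHS](big_seq1 +%R _ (fun m => g@_m)); case: b.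
(* The shift [n - j] plays the part of [-j] modulo [n], exponents being natural numbers. *)
- apply: (@cone_coef_class _ (i + j) (n - j) 0) => // m; rewrite inE mnm3P.
  apply/and3P/and3P => -[].
    move=> /eqP -> /eqP -> /eqP ->.
    by rewrite addn0 dvdn0 subnKC ?dvdnn // ltnW.
  move=> /eqP e /dvdnP[q Eq]; rewrite addn0 => /dvdnP[q' Eq'].
  have q1 : q = 1%N by nia.
  have q'0 : q' = 0%N by nia.
  subst q q'; split; apply/eqP; lia.
- apply: (@cone_coef_class _ (i + j) 0 (n - j)) => // m; rewrite inE mnm3P.
  apply/and3P/and3P => -[].
    move=> /eqP -> /eqP -> /eqP ->.
    by rewrite !addn0 dvdn0 subnKC ?dvdnn // ltnW.
  move=> /eqP e; rewrite addn0 => /dvdnP[q' Eq'] /dvdnP[q Eq].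
  have q1 : q = 1%N by nia.
  have q'0 : q' = 0%N by nia.
  subst q q'; split; apply/eqP; lia.
Qed.

(** In degree [i + n < 2n], the exponents of y and z can both be multiples of [n] only in x^i y^n,
    x^i z^n and x^(i+n); the last has coefficient zero, being a pure power. *)
Lemma cone_coef_swap i :
  (0 < i < n)%N -> g@_(mnm3 i n 0) = - g@_(mnm3 i 0 n).
Proof.
move=> /andP[i_gt0 i_ltn]; apply/eqP; rewrite -addr_eq0; apply/eqP.
have [ax _ _] := cone_coef_axis (i + n).
transitivity (\sum_(m <- [:: mnm3 i n 0; mnm3 i 0 n; mnm3 (i + n) 0 0]) g@_m).
  by rewrite !big_cons big_nil ax !addr0.
apply: (@cone_coef_class _ (i + n) 0 0) => [|m].
  rewrite /= !inE !mnm3P !mnm3E /point3 !inordK //=; lia.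
rewrite !inE !mnm3P !addn0.
apply/or3P/and3P => [|[/eqP e /dvdnP[q Eq] /dvdnP[q' Eq']]].
  by case=> /and3P[/eqP -> /eqP -> /eqP ->]; rewrite ?addn0 ?eqxx ?dvdnn ?dvdn0;
    split=> //; apply/eqP; lia.
have [[q1 q'0]|[[q0 q'1]|[q0 q'0]]] :
    (q = 1 /\ q' = 0 \/ q = 0 /\ q' = 1 \/ q = 0 /\ q' = 0)%N by nia.
- by apply: Or31; subst q q'; apply/and3P; split; apply/eqP; lia.
- by apply: Or32; subst q q'; apply/and3P; split; apply/eqP; lia.
- by apply: Or33; subst q q'; apply/and3P; split; apply/eqP; lia.
Qed.

End ConeOverFermatPoints.

(** * Two coefficients of a product of polynomials vanishing on the cone *)

Lemma mnm3_axis_eq b i j i' j' :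
  (mnm3_axis b i j == mnm3_axis b i' j') = (i == i') && (j == j').
Proof.
by case: b; rewrite mnm3P !mnm3E /point3 !inordK //= ?andbT //.
Qed.

Lemma mnm3_axisB b i j i' j' :
  (mnm3_axis b i j - mnm3_axis b i' j')%MM = mnm3_axis b (i - i') (j - j').
Proof. by case: b; rewrite mnm3B subnn. Qed.

Lemma mnm3_axis_le b i j i' j' :
  (mnm3_axis b i j <= mnm3_axis b i' j')%MM = (i <= i')%N && (j <= j')%N.
Proof. by case: b; rewrite mnm3_le leqnn ?andbT. Qed.

Lemma le_mnm3_axis m b i j :
  (m <= mnm3_axis b i j)%MM ->
  exists i' j', [/\ m = mnm3_axis b i' j', (i' <= i)%N & (j' <= j)%N].
Proof.
rewrite (mnm3_eta m); case: b; rewrite mnm3_le => /and3P[h0 h1 h2].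
- exists (m ord0), (m (inord 1)); split=> //.
  by move: h2; rewrite leqn0 => /eqP ->.
- exists (m ord0), (m (inord 2)); split=> //.
  by move: h1; rewrite leqn0 => /eqP ->.
Qed.

Section ProductCoefficients.
Variables (K : numFieldType) (n : nat) (w : K).
Hypothesis wP : n.-primitive_root w.
Variables f g : {mpoly K[3]}.
Hypotheses (fV : vanishes_on_cone w f) (gV : vanishes_on_cone w g).

(** When x^n y^(2n) is split between [f] and [g], an exponent of y other than [n] is below [n] in
    one of the factors, whose coefficient is then zero; the boundary cases give pure powers. *)
Lemma coefM_axis b :
  (f * g)@_(mnm3_axis b n (2 * n)) =
  \sum_(1 <= i < n) f@_(mnm3_axis b i n) * g@_(mnm3_axis b (n - i) n).
Proof.
have axis0 h : vanishes_on_cone w h ->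
    forall i, h@_(mnm3_axis b 0 i) = 0 /\ h@_(mnm3_axis b i 0) = 0.
  by move=> hV i; case: b (cone_coef_axis hV i) => -[].
rewrite mcoeffM_msupp.
rewrite (@sum_msupp_seq _ _ _ _ [seq mnm3_axis b i n | i <- index_iota 1 n]).
- rewrite big_map big_seq [RHS]big_seq; apply: eq_bigr => i.
  rewrite mem_index_iota => i_bd; rewrite mnm3_axis_le mnm3_axisB ifT; last by lia.
  by congr (_ * _@_(mnm3_axis b _ _)); rewrite mul2n -addnn addnK.
- rewrite map_inj_uniq ?iota_uniq // => i j /eqP.
  by rewrite mnm3_axis_eq => /andP[/eqP].
move=> m; case: ifP => [|_ _]; last by rewrite mulr0.
move=> /le_mnm3_axis[i [j [-> le_i le_j]]] Nm; rewrite mnm3_axisB.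
have [->|i_gt0] := posnP i; first by rewrite (axis0 f fV j).1 mul0r.
have [->|j_gt0] := posnP j; first by rewrite (axis0 f fV i).2 mul0r.
have [->|i_neqn] := eqVneq i n; first by rewrite subnn (axis0 g gV _).1 mulr0.
have [->|j_neq2n] := eqVneq j (2 * n)%N.
  by rewrite subnn (axis0 g gV _).2 mulr0.
have [lt_jn|lt_nj|eq_jn] := ltngtP j n.
- by rewrite (cone_coef_small wP fV) ?mul0r //; lia.
- by rewrite (cone_coef_small wP gV) ?mulr0 //; lia.
case/negP: Nm; rewrite eq_jn; apply: map_f; rewrite mem_index_iota; lia.
Qed.

(** Swapping y and z changes the sign of both factors of each term. *)
Lemma coefM_axis_sym :
  (f * g)@_(mnm3 n (2 * n) 0) = (f * g)@_(mnm3 n 0 (2 * n)).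
Proof.
rewrite (coefM_axis true) (coefM_axis false) big_seq [RHS]big_seq.
apply: eq_bigr => i; rewrite mem_index_iota => i_bd /=.
by rewrite (cone_coef_swap wP fV) ?(cone_coef_swap wP gV) ?mulrNN //; lia.
Qed.

End ProductCoefficients.

(** * Specialization to three variables *)

Lemma prod_ltn_pairs (A : comPzRingType) k (G : nat -> nat -> A) :
  \prod_(i < k) \prod_(j < k | (i < j)%N) G i j =
  \prod_(0 <= j < k) \prod_(0 <= i < j) G i j.
Proof.
rewrite (exchange_big_dep predT) //= big_mkord; apply: eq_bigr => j _.
by rewrite big_mkord (big_ord_widen _ (fun i => G i j) (ltnW (ltn_ord j))).
Qed.

Lemma mpolyX_mnm3 (K : comNzRingType) i j k :
  'X_[mnm3 i j k] =
  'X_(inord 0) ^+ i * 'X_(inord 1) ^+ j * 'X_(inord 2) ^+ k :> {mpoly K[3]}.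
Proof.
rewrite mpolyXE_id !big_ord_recl big_ord0 mulr1 mulrA !mnm3E.
have <- : lift ord0 ord0 = inord 1 :> 'I_3 by apply/val_inj; rewrite /= inordK.
have <- : lift ord0 (lift ord0 ord0) = inord 2 :> 'I_3.
  by apply/val_inj; rewrite /= inordK.
by have <- : ord0 = inord 0 :> 'I_3 by apply/val_inj; rewrite /= inordK.
Qed.

Section Specialization.
Variables (K : numFieldType) (n : nat).

(* The remaining variables are sent to nonzero constants whose [n]-th powers
   are distinct. *)
Definition plane_coord (i : nat) : {mpoly K[3]} :=
  if (i < 3)%N then 'X_(inord i) else (i%:R)%:MP.

Definition restrict_to_plane N (f : {mpoly K[N.+1]}) : {mpoly K[3]} :=
  f \mPo [tuple plane_coord i | i < N.+1].

(** With the larger index outermost, the factors in the three surviving variables alone can be split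
    off at [j = 3]. *)
Lemma restrict_fermat_poly N :
  restrict_to_plane (fermat_poly K N n) =
  \prod_(0 <= j < N.+1) \prod_(0 <= i < j)
    (plane_coord i ^+ n - plane_coord j ^+ n).
Proof.
rewrite /restrict_to_plane rmorph_prod -prod_ltn_pairs; apply: eq_bigr => i _.
rewrite rmorph_prod; apply: eq_bigr => j _.
by rewrite rmorphB !rmorphXn /= !comp_mpolyXU -!tnth_nth !tnth_mktuple.
Qed.

Lemma restrict_fermat_poly_coef N : (2 <= N)%N -> (0 < n)%N ->
  (restrict_to_plane (fermat_poly K N n))@_(mnm3 n (2 * n) 0) !=
  (restrict_to_plane (fermat_poly K N n))@_(mnm3 n 0 (2 * n)).
Proof.
move=> N_ge2 n_gt0.
rewrite restrict_fermat_poly (@big_cat_nat _ _ _ 3) //=.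
set U := \prod_(3 <= j < N.+1) _.
have U0 : U@_0 != 0.
  rewrite /U (rmorph_prod (mcoeff 0%MM)) /= big_nat prodf_seq_neq0.
  apply/allP => j _; apply/implyP => /andP[j_ge3 _].
  rewrite (rmorph_prod (mcoeff 0%MM)) /= big_nat prodf_seq_neq0.
  apply/allP => i _; apply/implyP => lt_ij.
  (* The constant term of [plane_coord k]; it differs at [i] and [j] as soon as [i < j] and
     [3 <= j]. *)
  pose c (k : nat) := if (k < 3)%N then 0%N else k.
  have cE k : (plane_coord k)@_0 = (c k)%:R.
    rewrite /plane_coord /c; case: ifP => _; last by rewrite mcoeffC eqxx mulr1.
    by rewrite mcoeffX mnm1_eq0.
  rewrite mcoeffB !(rmorphXn (mcoeff 0%MM)) /= !cE subr_eq0 -!natrX eqr_nat.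
  rewrite eqn_exp2r // /c; do 2![case: ifP => ?]; lia.
rewrite !big_nat_recr //= !big_geq // !mul1r.
set a := plane_coord 0 ^+ n; set b := plane_coord 1 ^+ n.
set c := plane_coord 2 ^+ n.
(* The six monomials are distinct and of the same degree, so each target monomial is divisible by
   itself only, and [U] contributes just its constant term. *)
have -> : (a - b) * ((a - c) * (b - c)) * U =
    'X_[mnm3 (2 * n) n 0] * U - 'X_[mnm3 (2 * n) 0 n] * U
  - 'X_[mnm3 n (2 * n) 0] * U + 'X_[mnm3 n 0 (2 * n)] * U
  + 'X_[mnm3 0 (2 * n) n] * U - 'X_[mnm3 0 n (2 * n)] * U.
  rewrite !mpolyX_mnm3 !(mulnC 2%N) !exprM -/a -/b -/c; ring.
rewrite !(mcoeffB, mcoeffD) !mcoeffXM !mnm3_le !mnm3B !leqnn.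
have -> : (2 * n <= n)%N = false by lia.
have -> : (2 * n <= 0)%N = false by lia.
have -> : (n <= 0)%N = false by lia.
rewrite !subnn /= !(subr0, addr0, add0r, sub0r).
have -> : mnm3 0 0 0 = 0%MM by apply/mnmP => -[[|[|[|//]]] ?]; rewrite mnm3E mnm0E.
(* The two coefficients are [- U@_0] and [U@_0], and 2 is nonzero in [K]. *)
by rewrite andbF subr0 -subr_eq0 -opprD oppr_eq0 -mulr2n mulrn_eq0.
Qed.

End Specialization.

Lemma meval_restrict_to_plane (K : numFieldType) N (f : {mpoly K[N.+1]}) v :
  (restrict_to_plane f).@[v] = f.@[fun i : 'I_N.+1 => (plane_coord K i).@[v]].
Proof.
rewrite comp_mpoly_meval; apply: meval_eq => i.
by rewrite tnth_mktuple.
Qed.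

Lemma meval_plane_coord (K : numFieldType) i (x y z : K) :
  (plane_coord K i).@[point3 x y z] =
  if (i < 3)%N then nth 0 [:: x; y; z] i else i%:R.
Proof.
rewrite /plane_coord; case: ifP => [lt_i3|_]; last by rewrite mevalC.
by rewrite mevalXU /point3 inordK //; apply: set_nth_default.
Qed.

(** * Hyperplanes as zero sets of linear forms *)

Section LinearFormZeros.
Variables (K : fieldType) (k : nat).
Implicit Types (l : {mpoly K[k]}) (v : 'rV[K]_k).

Definition meval_row l v : K := l.@[fun i => v 0 i].

(** Written as the kernel of a linear map to a line, so that its dimension follows from
    rank-nullity. *)
Definition zeros l : {vspace 'rV[K]_k} :=
  lker (linfun (mulmxr (\col_(i < k) l@_U_(i)) : 'rV[K]_k -> 'rV[K]_1)).

Lemma mpoly_homog1 l : l \is 1.-homog -> l = \sum_(i < k) l@_U_(i) *: 'X_i.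
Proof.
move=> l_homog; apply/mpolyP => m; rewrite linear_sum /=.
have [/eqP/mdeg1P[i /eqP ->]|mdeg_m] := eqVneq (mdeg m) 1%N.
  rewrite (bigD1 i) //= big1 => [|j ji]; rewrite mcoeffZ mcoeffXU.
    by rewrite eqxx mulr1 addr0.
  by rewrite (negPf ji) mulr0.
rewrite (dhomog_nemf_coeff l_homog) // big1 // => i _.
rewrite mcoeffZ mcoeffX; case: eqP => [Em|]; last by rewrite mulr0.
by rewrite -Em mdeg1 eqxx in mdeg_m.
Qed.

Lemma mem_zeros l v : l \is 1.-homog -> (v \in zeros l) = (meval_row l v == 0).
Proof.
move=> l_homog; rewrite memv_ker lfunE /= /meval_row [in RHS](mpoly_homog1 l_homog).
rewrite linear_sum /=.
have -> : \sum_(i < k) (l@_U_(i) *: 'X_i).@[fun i => v 0 i] =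
    (v *m \col_(i < k) l@_U_(i)) 0 0.
  by rewrite mxE; apply: eq_bigr => i _; rewrite mevalZ mevalXU mxE mulrC.
apply/eqP/eqP => [->|h]; first by rewrite mxE.
by apply/rowP => i; rewrite ord1 h mxE.
Qed.

Lemma dim_zeros l : l \is 1.-homog -> l != 0 -> (\dim (zeros l)).+1 = k.
Proof.
move=> l_homog l_neq0.
have := limg_ker_dim
  (linfun (mulmxr (\col_(i < k) l@_U_(i)) : 'rV[K]_k -> 'rV[K]_1)) fullv.
rewrite capfv -/(zeros l) dimvf /dim /= mul1n.
set im := (_ @: _)%VS.
have im_le1 : (\dim im <= 1)%N by rewrite (leq_trans (dimvS (subvf _))) ?dimvf.
have : \dim im != 0%N.
  rewrite dimv_eq0; apply: contraNneq l_neq0 => im0.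
  rewrite (mpoly_homog1 l_homog) big1 // => i _.
  have : linfun (mulmxr (\col_(i < k) l@_U_(i)) : 'rV[K]_k -> 'rV[K]_1)
    (delta_mx 0 i) \in im by rewrite memv_img ?memvf.
  rewrite im0 memv0 lfunE /= -rowE => /eqP/rowP/(_ 0).
  by rewrite !mxE => ->; rewrite scale0r.
by case: (\dim im) im_le1 => [|[|d]] //= _ _; rewrite addn1.
Qed.

End LinearFormZeros.

(** * Irreducibility of linear subspaces *)

Section Irreducibility.
Variables (K : numFieldType) (k : nat).
Implicit Types (f g : {mpoly K[k]}) (W : {vspace 'rV[K]_k}).

Lemma meval_line f (u v : 'rV[K]_k) :
  exists p : {poly K}, forall t, p.[t] = meval_row f (u + t *: v).
Proof.
exists (mmap (@polyC K) (fun i => (u 0 i)%:P + 'X * (v 0 i)%:P) f) => t.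
rewrite /meval_row mevalE /mmap horner_sum; apply: eq_bigr => m _.
rewrite hornerM hornerC; congr (_ * _).
rewrite /mmap1 horner_prod; apply: eq_bigr => i _.
by rewrite horner_exp !hornerE !mxE.
Qed.

(** The line through [u] (at [t = 0]) and [v] (at [t = 1]) lies in [W]; on it [f] and [g] restrict
    to nonzero one-variable polynomials, whose product is nonzero somewhere because [K] is
    infinite. *)
Lemma vspace_meval_mul W f g :
    (exists2 v, v \in W & meval_row f v != 0) ->
    (exists2 v, v \in W & meval_row g v != 0) ->
  exists2 v, v \in W & meval_row (f * g) v != 0.
Proof.
move=> [u uW fu] [v vW gv].
have [p pE] := meval_line f u (v - u); have [q qE] := meval_line g u (v - u).
have pq0 : p * q != 0.
  rewrite mulf_neq0 //.
    apply: contraNneq fu => p0.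
    by rewrite -[u]addr0 -(scale0r (v - u)) -pE p0 horner0.
  apply: contraNneq gv => q0.
  by rewrite -[v](subrKC u) -[v - u]scale1r -qE q0 horner0.
apply: contrapT => noW; case/eqP: pq0; apply: poly_eq0_char0 => t _.
apply: contrapT => /eqP pqt; apply: noW; exists (u + t *: (v - u)).
  by rewrite rpredD // rpredZ // rpredB.
by move: pqt; rewrite hornerM pE qE /meval_row mevalM.
Qed.

Lemma vspace_meval_prod W (I : finType) (P : pred I) (F : I -> {mpoly K[k]}) :
    (forall i, P i -> exists2 v, v \in W & meval_row (F i) v != 0) ->
  exists2 v, v \in W & meval_row (\prod_(i | P i) F i) v != 0.
Proof.
move=> hF.
apply: (big_ind (fun f => exists2 v, v \in W & meval_row f v != 0)) => //;
  last exact: vspace_meval_mul.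
by exists 0; rewrite ?mem0v // /meval_row meval1 oner_eq0.
Qed.

Lemma vspace_meval_prod_eq0 W (I : finType) (P : pred I)
    (F : I -> {mpoly K[k]}) :
    (forall v, v \in W -> meval_row (\prod_(i | P i) F i) v = 0) ->
  exists2 i, P i & forall v, v \in W -> meval_row (F i) v = 0.
Proof.
move=> F0; apply: contrapT => noi.
have [i Pi|v vW] := @vspace_meval_prod W I P F; last by rewrite F0 ?eqxx.
apply: contrapT => nov; apply: noi; exists i => // v vW.
by apply: contrapT => /eqP Fv; apply: nov; exists v.
Qed.

End Irreducibility.

(** * Factorization of x^n - y^n into linear factors *)

Lemma subXX_prim_root_field (F : fieldType) n (w x y : F) :
  n.-primitive_root w -> y != 0 ->
  x ^+ n - y ^+ n = \prod_(i < n) (x - w ^+ i * y).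
Proof.
move=> wP y_neq0.
have /(congr1 (horner^~ (x / y))) := factor_Xn_sub_1 wP.
rewrite horner_prod hornerD hornerN hornerXn hornerC big_mkord.
move/(congr1 (fun z => z * y ^+ n)).
rewrite mulrBl mul1r -exprMn divfK // => <-.
rewrite -[X in _ ^+ X]card_ord -prodr_const -big_split /=.
by apply: eq_bigr => j _; rewrite hornerXsubC mulrBl divfK.
Qed.

(** The field case divides by [y]; an embedding carries the identity back to a ring such as the
    polynomials inside their fraction field. *)
Lemma subXX_prim_root_inj (A : pzRingType) (F : fieldType)
    (phi : {rmorphism A -> F}) n (w x y : A) :
  injective phi -> n.-primitive_root (phi w) -> y != 0 ->
  x ^+ n - y ^+ n = \prod_(i < n) (x - w ^+ i * y).
Proof.
move=> phi_inj wP y_neq0.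
have phiy : phi y != 0 by rewrite -(rmorph0 phi) (inj_eq phi_inj).
apply: phi_inj.
rewrite rmorphB !rmorphXn (subXX_prim_root_field _ wP phiy) rmorph_prod.
by apply: eq_bigr => i _; rewrite rmorphB rmorphM rmorphXn.
Qed.

Lemma subXX_prim_root (K : fieldType) k n (w : K) (x y : {mpoly K[k]}) :
  n.-primitive_root w -> y != 0 ->
  x ^+ n - y ^+ n = \prod_(i < n) (x - w ^+ i *: y).
Proof.
move=> wP y_neq0.
pose phi : {rmorphism K -> {fraction {mpoly K[k]}}} :=
  (@FracField.tofrac {mpoly K[k]}) \o (@mpolyC k K).
have phi_inj : injective (@FracField.tofrac {mpoly K[k]}).
  by move=> p q /eqP; rewrite tofrac_eq => /eqP.
have phiw : n.-primitive_root (FracField.tofrac w%:MP_[k]).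
  by move: wP; rewrite -(fmorph_primitive_root phi).
rewrite (subXX_prim_root_inj _ phi_inj phiw y_neq0).
by apply: eq_bigr => i _; rewrite -mul_mpolyC rmorphXn.
Qed.

(** * Membership in ordinary and symbolic powers *)

Lemma ideal_pow3_mul (A : comNzRingType) (I : set A) a x y z :
  I x -> I y -> I z -> ideal_pow I 3 (a * (x * y * z)).
Proof.
move=> Ix Iy Iz; exists 1%N, (fun _ => a), (fun _ => x * y * z).
split; last by rewrite big_ord1.
move=> _; exists (fun i : 'I_3 => nth x [:: x; y; z] i); split.
  by case=> [[|[|[|//]]]].
by rewrite !big_ord_recl big_ord0 /= mulr1 mulrA.
Qed.

(** Outside [P] the element [s] becomes a unit of the localization, so it can be divided out. *)
Lemma symbolic_power_of_multiple (A : idomainType) (I : set A) m g :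
    (forall P, Ass I P -> exists2 s, ~ P s & ideal_pow I m (s * g)) ->
  symbolic_power I m g.
Proof.
move=> h P AssP; have [s Ps sg] := h P AssP.
have s_neq0 : FracField.tofrac s != 0.
  rewrite tofrac_eq0; apply/eqP => s0; apply: Ps.
  case: AssP => [[[+ _ _] _] _]; rewrite s0.
  by move=> /set_mem.
exists 1%N, (fun _ => FracField.tofrac 1 / FracField.tofrac s), (fun _ => s * g).
split=> //; first by move=> _; exists 1, s.
by rewrite big_ord1 tofrac1 mul1r tofracM mulKf.
Qed.

(** * The arrangement, its flats, and the third symbolic power *)

Section FermatFactors.
Variables (K : numFieldType) (N n : nat) (w : K).
Hypothesis wP : n.-primitive_root w.

Let index := ('I_N.+1 * 'I_N.+1 * 'I_n)%type.
Implicit Types (e : index) (v : 'rV[K]_N.+1).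

Definition fermat_factor e : {mpoly K[N.+1]} :=
  'X_e.1.1 - w ^+ e.2 *: 'X_e.1.2.

Lemma fermat_poly_factor :
  fermat_poly K N n = \prod_(e : index | (e.1.1 < e.1.2)%N) fermat_factor e.
Proof.
rewrite /fermat_poly pair_big_dep /=.
transitivity (\prod_(p : 'I_N.+1 * 'I_N.+1 | (p.1 < p.2)%N)
    \prod_(i < n) fermat_factor (p, i)).
  apply: eq_bigr => -[i j] _; apply: subXX_prim_root => //.
  by rewrite -msupp_eq0 msuppX.
by rewrite pair_big_dep; apply: eq_big => [[p i]|[p i] _] //=; rewrite andbT.
Qed.

Lemma fermat_factor_homog e : fermat_factor e \is 1.-homog.
Proof. by rewrite rpredB ?rpredZ // dhomogX /= mdeg1. Qed.

Lemma fermat_factor_neq0 e : (e.1.1 < e.1.2)%N -> fermat_factor e != 0.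
Proof.
move=> lt_e; apply/eqP => /(congr1 (mcoeff U_(e.1.1))).
rewrite mcoeffB mcoeffZ !mcoeffXU mcoeff0 eqxx.
have -> : (e.1.2 == e.1.1) = false by rewrite -(inj_eq val_inj) gtn_eqF.
by rewrite mulr0 subr0 => /eqP; rewrite oner_eq0.
Qed.

Lemma mem_zeros_fermat_factor e v :
  (v \in zeros (fermat_factor e)) = (v 0 e.1.1 == w ^+ e.2 * v 0 e.1.2).
Proof.
rewrite mem_zeros ?fermat_factor_homog // /meval_row mevalB mevalZ !mevalXU.
by rewrite subr_eq0.
Qed.

(** The product of the factors vanishes on [H], which is irreducible, so one factor vanishes on [H];
    equality follows by comparing dimensions. *)
Lemma fermat_hyperplaneP (H : {vspace 'rV[K]_N.+1}) :
  fermat_hyperplane n H <->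
  exists2 e : index, (e.1.1 < e.1.2)%N & H = zeros (fermat_factor e).
Proof.
split=> [[l [l_neq0 l_homog [q Fq] HE]]|[e lt_e ->]]; last first.
  exists (fermat_factor e).
  split; rewrite ?fermat_factor_neq0 ?fermat_factor_homog //.
    exists (\prod_(e' : index | (e'.1.1 < e'.1.2)%N && (e' != e))
      fermat_factor e').
    by rewrite fermat_poly_factor (bigD1 e).
  move=> v; rewrite mem_zeros ?fermat_factor_homog //.
  by split=> [/eqP|/eqP].
have HE' : H = zeros l.
  apply/vspaceP => v; rewrite mem_zeros //.
  by apply/idP/eqP => /HE.
have [|e lt_e He] := @vspace_meval_prod_eq0 K N.+1 H index
    (fun e => (e.1.1 < e.1.2)%N) fermat_factor.
  move=> v /HE lv; rewrite -fermat_poly_factor Fq.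
  by rewrite /meval_row mevalM lv mul0r.
exists e => //; apply/eqP; rewrite eqEdim; apply/andP; split.
  apply/subvP => v /He ev; rewrite mem_zeros ?fermat_factor_homog //.
  exact/eqP.
rewrite -ltnS HE' dim_zeros ?fermat_factor_homog ?fermat_factor_neq0 //.
by rewrite dim_zeros.
Qed.

Lemma dim_fermat_hyperplane (H : {vspace 'rV[K]_N.+1}) :
  fermat_hyperplane n H -> \dim H = N.
Proof.
move=> /fermat_hyperplaneP[e lt_e ->]; apply: succn_inj.
by rewrite dim_zeros ?fermat_factor_homog ?fermat_factor_neq0.
Qed.

Lemma dim_cap_fermat_hyperplane (H1 H2 : {vspace 'rV[K]_N.+1}) :
  fermat_hyperplane n H1 -> fermat_hyperplane n H2 -> H1 <> H2 ->
  (\dim (H1 :&: H2) + 2 = N.+1)%N.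
Proof.
move=> /dim_fermat_hyperplane d1 /dim_fermat_hyperplane d2 neq12.
have := dimv_sum_cap H1 H2; rewrite d1 d2.
suff -> : \dim (H1 + H2) = N.+1.
  by move: (\dim (H1 :&: H2)) => d; lia.
apply/eqP; rewrite eqn_leq; apply/andP; split.
  by have := dimvS (subvf (H1 + H2)); rewrite dimvf /dim /= mul1n.
rewrite ltnNge; apply/negP => le_dim; apply: neq12; apply/eqP.
rewrite eqEdim d1 d2 leqnn andbT.
apply: subv_trans (addvSl H1 H2) _.
have: H2 == (H1 + H2)%VS by rewrite eqEdim addvSr d2.
by move/eqP => <-.
Qed.

Lemma fermat_flat_cap (W H1 H2 : {vspace 'rV[K]_N.+1}) :
  (\dim W + 2 = N.+1)%N ->
  fermat_hyperplane n H1 -> fermat_hyperplane n H2 -> H1 <> H2 ->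
  (W <= H1)%VS -> (W <= H2)%VS -> W = (H1 :&: H2)%VS.
Proof.
move=> dimW h1 h2 neq12 W1 W2; apply/eqP.
rewrite eqEdim subv_cap W1 W2 /=.
by rewrite -(leq_add2r 2) dimW (dim_cap_fermat_hyperplane h1 h2 neq12).
Qed.

Lemma fermat_idealP (f : {mpoly K[N.+1]}) :
  fermat_ideal n f <-> forall v, fermat_locus n v -> meval_row f v = 0.
Proof. by []. Qed.

(* If [s] does not vanish at a point of a flat [W'] then every hyperplane of the
   arrangement through [W'] also contains [W], whence [W = W']. *)
Lemma fermat_ideal_mul_factor (W : {vspace 'rV[K]_N.+1}) e :
  (\dim W + 2 = N.+1)%N -> (W <= zeros (fermat_factor e))%VS ->
  fermat_ideal n (fermat_factor e *
    \prod_(e' : index | (e'.1.1 < e'.1.2)%N &&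
      ~~ (W <= zeros (fermat_factor e'))%VS) fermat_factor e').
Proof.
move=> dimW We; apply/fermat_idealP => v [_ [W' [dimW' flatW'] vW']].
set s := \prod_(e' | _) _; rewrite /meval_row mevalM.
have [->|sv] := eqVneq s.@[fun i => v 0 i] 0; first by rewrite mulr0.
suff /(subvP We) : v \in W.
  by rewrite mem_zeros ?fermat_factor_homog /meval_row // => /eqP ->; rewrite mul0r.
case: flatW' => H1 [H2 [_ [[neq12 _ _] [[h1 h2 _] [W'1 W'2 _]]]]].
have sub_of (H : {vspace 'rV[K]_N.+1}) :
    fermat_hyperplane n H -> (W' <= H)%VS -> (W <= H)%VS.
  move=> /fermat_hyperplaneP[e' lt_e' HE] W'H; apply: contraNT sv => WH.
  rewrite /s (bigD1 e') -?HE ?lt_e' //= mevalM.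
  have := subvP W'H v vW'; rewrite HE mem_zeros ?fermat_factor_homog /meval_row //.
  by move=> /eqP ->; rewrite mul0r.
rewrite (fermat_flat_cap dimW h1 h2 neq12) ?sub_of //.
by rewrite -(fermat_flat_cap dimW' h1 h2 neq12).
Qed.

Lemma fermat_poly_in_symbolic_power :
  symbolic_power (@fermat_ideal K N n) 3 (fermat_poly K N n).
Proof.
apply: symbolic_power_of_multiple => P [[[_ P1 _] _] [f PE]].
(* Otherwise [f] would be in the ideal and 1 in the proper ideal [P]. *)
have [v0 v0L fv0] : exists2 v, fermat_locus n v & meval_row f v != 0.
  apply: contrapT => nov; case/negP: P1; apply/mem_set; rewrite PE /= mul1r.
  apply/fermat_idealP => v vL; apply: contrapT => /eqP fv.
  by apply: nov; exists v.
case: v0L => v0_neq0 [W flatW v0W]; have [dimW flatW'] := flatW.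
case: flatW' => H1 [H2 [H3 [[neq12 neq13 neq23] [[h1 h2 h3] [W1 W2 W3]]]]].
case/fermat_hyperplaneP: h1 => e1 lt_e1 H1E.
case/fermat_hyperplaneP: h2 => e2 lt_e2 H2E.
case/fermat_hyperplaneP: h3 => e3 lt_e3 H3E.
subst H1 H2 H3.
have e21 : e2 != e1 by apply/eqP => e12; apply: neq12; rewrite e12.
have e31 : e3 != e1 by apply/eqP => e13; apply: neq13; rewrite e13.
have e32 : e3 != e2 by apply/eqP => e23; apply: neq23; rewrite e23.
pose s := \prod_(e : index | (e.1.1 < e.1.2)%N &&
  ~~ (W <= zeros (fermat_factor e))%VS) fermat_factor e.
have [i v0i] : exists i, v0 0 i != 0.
  by apply/rV0Pn.
(* The factor ['X_i] only ensures that [v] is nonzero, hence a point of the locus. *)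
have [v vW] : exists2 v, v \in W & meval_row (f * 'X_i * s) v != 0.
  apply: vspace_meval_mul.
    by exists v0; rewrite // /meval_row mevalM mevalXU mulf_neq0.
  apply: vspace_meval_prod => e /andP[lt_e /subvPn[v vW ve]].
  by exists v; rewrite -?mem_zeros ?fermat_factor_homog.
rewrite /meval_row !mevalM mevalXU !mulf_eq0 !negb_or => /andP[/andP[fv vi] sv].
exists (s ^+ 3).
  rewrite PE => /fermat_idealP /(_ v) => sf0.
  have /eqP : meval_row (s ^+ 3 * f) v = 0.
    apply: sf0; split; last by exists W.
    by apply: contraNneq vi => ->; rewrite mxE.
  rewrite /meval_row mevalM rmorphXn /= mulf_eq0 expf_eq0 /=.
  by rewrite (negPf fv) (negPf sv).
rewrite fermat_poly_factor.
rewrite (bigID (fun e => (W <= zeros (fermat_factor e))%VS)) /= -/s.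
rewrite (bigD1 e1) ?lt_e1 ?W1 //= (bigD1 e2) ?lt_e2 ?W2 ?e21 //=.
rewrite (bigD1 e3) ?lt_e3 ?W3 ?e31 ?e32 //=.
set q := \prod_(e | _) _.
(* Each of the three factors through [W] takes one copy of [s]; the copy already in the Fermat
   polynomial stays in the cofactor. *)
have -> : s ^+ 3 * (fermat_factor e1 * (fermat_factor e2 *
    (fermat_factor e3 * q)) * s) =
  (q * s) * ((fermat_factor e1 * s) * (fermat_factor e2 * s) *
    (fermat_factor e3 * s)) by ring.
by apply: ideal_pow3_mul; apply: fermat_ideal_mul_factor.
Qed.

End FermatFactors.

(** * Explicit points of the locus *)

Section FermatLocus.
Variables (K : numFieldType) (N n : nat) (w : K).
Hypothesis wP : n.-primitive_root w.

Let index := ('I_N.+1 * 'I_N.+1 * 'I_n)%type.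
Implicit Types (e : index) (v : 'rV[K]_N.+1).

Let w_neq0 : w != 0.
Proof.
apply: contra_eq_neq (prim_expr_order wP) => ->.
by rewrite expr0n gtn_eqF ?(prim_order_gt0 wP) // eq_sym oner_eq0.
Qed.

(** The basis vectors outside the hyperplane are those of index [i] or [j], as [w] is nonzero, which
    recovers the pair; the vector w^k e_i + e_j then recovers [k]. *)
Lemma zeros_fermat_factor_inj e e' :
  (e.1.1 < e.1.2)%N -> (e'.1.1 < e'.1.2)%N ->
  zeros (fermat_factor w e) = zeros (fermat_factor w e') -> e = e'.
Proof.
case: e e' => [[i j] k] [[i' j'] k'] /= lt_ij lt_ij' eq_ee'.
have eq_mem v : (v 0 i == w ^+ k * v 0 j) = (v 0 i' == w ^+ k' * v 0 j').
  by rewrite -!(mem_zeros_fermat_factor w (_, _, _)) eq_ee'.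
have neq_ij (a b : 'I_N.+1) : (a < b)%N -> (a == b) = false.
  by move=> ltab; apply: negbTE; rewrite -(inj_eq val_inj) ltn_eqF.
have delta_nmem (a b : 'I_N.+1) (c : 'I_n) m : (a < b)%N ->
    ((delta_mx 0 m : 'rV[K]_N.+1) 0 a == w ^+ c * (delta_mx 0 m : 'rV[K]_N.+1) 0 b)
    = (m != a) && (m != b).
  move=> lt_ab; rewrite !mxE eqxx /= [a == m]eq_sym [b == m]eq_sym.
  have [->|_] := eqVneq m a; first by rewrite (neq_ij _ _ lt_ab) mulr0 oner_eq0.
  have [_|_] := eqVneq m b; last by rewrite mulr0 eqxx.
  by rewrite mulr1 eq_sym (negPf (expf_neq0 _ w_neq0)).
have pairs m : (m != i) && (m != j) = (m != i') && (m != j').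
  by rewrite -(delta_nmem i j k) // -(delta_nmem i' j' k').
have ii' : i = i' /\ j = j'.
  move: (pairs i) (pairs j) (pairs i') (pairs j').
  have ordE (a b : 'I_N.+1) : (a == b) = ((a : nat) == b) by [].
  rewrite !eqxx !ordE => p1 p2 p3 p4.
  by split; apply: val_inj => /=; lia.
case: ii' => ? ?; subst i' j'.
have := eq_mem (w ^+ k *: delta_mx 0 i + delta_mx 0 j); set v := _ + _.
have -> : v 0 i = w ^+ k.
  by rewrite !mxE !eqxx (neq_ij _ _ lt_ij) mulr1 addr0.
have -> : v 0 j = 1.
  by rewrite !mxE !eqxx eq_sym (neq_ij _ _ lt_ij) mulr0 add0r.
rewrite !mulr1 eqxx => /esym.
rewrite (eq_prim_root_expr wP) !modn_small // => /eqP kk'.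
by rewrite (val_inj kk').
Qed.

Lemma mem_fermat_locus v e1 e2 e3 :
    v != 0 ->
    [/\ (e1.1.1 < e1.1.2)%N, (e2.1.1 < e2.1.2)%N & (e3.1.1 < e3.1.2)%N] ->
    [/\ e1 != e2, e1 != e3 & e2 != e3] ->
    v \in zeros (fermat_factor w e1) -> v \in zeros (fermat_factor w e2) ->
    (zeros (fermat_factor w e1) :&: zeros (fermat_factor w e2)
       <= zeros (fermat_factor w e3))%VS ->
  fermat_locus n v.
Proof.
move=> v_neq0 [lt1 lt2 lt3] [neq12 neq13 neq23] v1 v2 sub3.
have hyp e : (e.1.1 < e.1.2)%N -> fermat_hyperplane n (zeros (fermat_factor w e)).
  by move=> lt_e; apply/(fermat_hyperplaneP wP); exists e.
have inj e e' : (e.1.1 < e.1.2)%N -> (e'.1.1 < e'.1.2)%N -> e != e' ->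
    zeros (fermat_factor w e) <> zeros (fermat_factor w e').
  by move=> lt_e lt_e' /eqP neq /(zeros_fermat_factor_inj lt_e lt_e').
split=> //.
exists (zeros (fermat_factor w e1) :&: zeros (fermat_factor w e2))%VS;
  last by rewrite memv_cap v1.
split.
  apply: (dim_cap_fermat_hyperplane wP);
    [exact: hyp | exact: hyp | exact: inj].
exists (zeros (fermat_factor w e1)), (zeros (fermat_factor w e2)),
  (zeros (fermat_factor w e3)); split; first by split; exact: inj.
by split; split; rewrite ?capvSl ?capvSr //; exact: hyp.
Qed.

(** The subspace x_i = x_j = 0 lies on every x_i = w^k x_j; the bound on [n] provides the three
    exponents 0, 1, 2. *)
Lemma mem_fermat_locus_axis v (i j : 'I_N.+1) :
  (2 < n)%N -> (i < j)%N -> v != 0 -> v 0 i = 0 -> v 0 j = 0 -> fermat_locus n v.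
Proof.
move=> n_gt2 lt_ij v_neq0 vi vj.
have n_gt1 := ltnW n_gt2; have n_gt0 := ltnW n_gt1.
apply: (@mem_fermat_locus v (i, j, Ordinal n_gt0) (i, j, Ordinal n_gt1)
  (i, j, Ordinal n_gt2)) => //.
- by rewrite !xpair_eqE -!(inj_eq val_inj) /= !andbF.
- by rewrite mem_zeros_fermat_factor /= vi vj mulr0.
- by rewrite mem_zeros_fermat_factor /= vi vj mulr0.
apply/subvP => u; rewrite memv_cap !mem_zeros_fermat_factor /= expr0 mul1r expr1.
move=> /andP[/eqP -> /eqP u_eq].
have w_neq1 : w - 1 != 0.
  by rewrite subr_eq0 -[w]expr1 -(prim_order_dvd wP) dvdn1 gtn_eqF.
suff -> : u 0 j = 0 by rewrite mulr0.
by apply: (mulfI w_neq1); rewrite mulrBl mul1r -u_eq subrr mulr0.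
Qed.

Lemma mem_fermat_locus_diag v (i j l : 'I_N.+1) b c :
  (i < j)%N -> (j < l)%N -> v 0 i != 0 ->
  v 0 j = w ^+ b * v 0 i -> v 0 l = w ^+ c * v 0 i -> fermat_locus n v.
Proof.
move=> lt_ij lt_jl vi vj vl.
have wX_neq0 d : w ^+ d != 0 by rewrite expf_neq0.
(* The hyperplanes solve for the coordinate of smaller index, so inverses and quotients of powers of
   [w] must be rewritten as powers with exponent below [n]. *)
have root1 d : (w ^+ d) ^+ n = 1 by rewrite exprAC (prim_expr_order wP) expr1n.
have rootV d : (w ^+ d)^-1 ^+ n = 1 by rewrite exprVn root1 invr1.
have [k1 k1E] := prim_rootP wP (rootV b).
have [k2 k2E] := prim_rootP wP (rootV c).
have [k3 k3E] : {k : 'I_n | w ^+ b * (w ^+ c)^-1 = w ^+ k}.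
  by apply: (prim_rootP wP); rewrite exprMn root1 rootV mulr1.
have neq_ij : i != j by rewrite -(inj_eq val_inj) ltn_eqF.
have neq_jl : j != l by rewrite -(inj_eq val_inj) ltn_eqF.
apply: (@mem_fermat_locus v (i, j, k1) (i, l, k2) (j, l, k3)) => //=.
- by apply: contraNneq vi => ->; rewrite mxE.
- by split=> //; exact: ltn_trans lt_jl.
- by rewrite !xpair_eqE (negPf neq_ij) (negPf neq_jl) !andbF.
- by rewrite mem_zeros_fermat_factor /= -k1E vj mulKf.
- by rewrite mem_zeros_fermat_factor /= -k2E vl mulKf.
apply/subvP => u; rewrite memv_cap !mem_zeros_fermat_factor /= -k1E -k2E -k3E.
move=> /andP[/eqP -> /eqP u_eq].
by rewrite -mulrA -u_eq mulVKf.
Qed.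

End FermatLocus.

(** * The Fermat polynomial is outside the square of the ideal *)

Lemma restrict_to_plane_vanishes (K : numFieldType) N n (w : K)
    (f : {mpoly K[N.+1]}) :
  n.-primitive_root w -> (2 <= N)%N -> (2 < n)%N -> fermat_ideal n f ->
  vanishes_on_cone w (restrict_to_plane f).
Proof.
move=> wP N_ge2 n_gt2 fI t t_neq0.
have [lt0 lt1 lt2] : [/\ 0 < N.+1, 1 < N.+1 & 2 < N.+1]%N by split; lia.
pose o0 := Ordinal lt0; pose o1 := Ordinal lt1; pose o2 := Ordinal lt2.
(* A point of the cone lifts to (x, y, z, 3, ..., N); the flat through it involves only the first
   three coordinates. *)
have eval x y z (v := \row_(i < N.+1) (plane_coord K i).@[point3 x y z]) :
    (fermat_locus n v -> (restrict_to_plane f).@[point3 x y z] = 0) *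
    (v 0 o0 = x) * (v 0 o1 = y) * (v 0 o2 = z).
  rewrite !mxE !meval_plane_coord; do 3![split=> //].
  move=> /fI <-; rewrite meval_restrict_to_plane.
  by apply: meval_eq => i; rewrite mxE.
split=> [|||b c]; rewrite eval //.
- apply: (@mem_fermat_locus_axis _ _ _ w wP _ o1 o2) => //; rewrite ?eval //.
  by apply: contraNneq t_neq0 => v0; rewrite -[t](eval t 0 0).1.1.2 v0 mxE.
- apply: (@mem_fermat_locus_axis _ _ _ w wP _ o0 o2) => //; rewrite ?eval //.
  by apply: contraNneq t_neq0 => v0; rewrite -[t](eval 0 t 0).1.2 v0 mxE.
- apply: (@mem_fermat_locus_axis _ _ _ w wP _ o0 o1) => //; rewrite ?eval //.
  by apply: contraNneq t_neq0 => v0; rewrite -[t](eval 0 0 t).2 v0 mxE.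
- by apply: (@mem_fermat_locus_diag _ _ _ w wP _ o0 o1 o2 b c) => //; rewrite ?eval.
Qed.

Lemma fermat_poly_notin_ideal_pow2 (K : numFieldType) N n (w : K) :
  n.-primitive_root w -> (2 <= N)%N -> (2 < n)%N ->
  ~ ideal_pow (@fermat_ideal K N n) 2 (fermat_poly K N n).
Proof.
move=> wP N_ge2 n_gt2 [r [a [s [sI FE]]]].
have n_gt0 : (0 < n)%N by lia.
case/negP: (@restrict_fermat_poly_coef K n N N_ge2 n_gt0); apply/eqP.
(* Both coefficients are additive, so one term of the sum suffices; its multiplier is absorbed into
   the first of the two ideal elements. *)
rewrite FE /restrict_to_plane !rmorph_sum !linear_sum /=; apply: eq_bigr => i _.
have [g [gI ->]] := sI i; rewrite !big_ord_recl big_ord0 mulr1 mulrA !rmorphM /=.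
apply: (coefM_axis_sym wP); last exact: restrict_to_plane_vanishes (gI _).
by apply: vanishes_on_coneM; exact: restrict_to_plane_vanishes (gI _).
Qed.

Local Open Scope classical_set_scope.

Theorem theorem4p1 (R : realType) (N n : nat) (hN : (2 <= N)%N)
    (hn : (3 <= n)%N) :
  ~ (symbolic_power (@fermat_ideal R[i] N n) 3
       `<=` ideal_pow (@fermat_ideal R[i] N n) 2).
Proof.
have n_gt0 : (0 < n)%N by lia.
have [w wP] := @primitive_root_exists R[i] n n_gt0.
move=> /(_ _ (fermat_poly_in_symbolic_power wP)).
exact: (fermat_poly_notin_ideal_pow2 wP).
Qed.
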